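(* Let $n\ge 1$ be a natural number and let $f(x)$ be a polynomial with real or complex coefficients of degree less than or equal to $n$. Then for every natural number $m\geq 1$, $$\sum_{x=1}^{m}f(x)=m f(0)+\sum_{i=1}^{n}\frac{d_i}{i+1}\,m(m+1)(m+2)\cdots(m+i),$$ where $$d_i=\sum_{k=0}^{i}\frac{(-1)^k f(-k)}{k!\,(i-k)!}\qquad (i=1,2,\ldots,n).$$
   Context: Natural numbers are the positive integers. *)

(* Defs.v *)
From mathcomp Require Import all_boot all_order all_algebra.
Set Implicit Arguments.
Unset Strict Implicit.
Unset Printing Implicit Defensive.
Import GRing.Theory.
Local Open Scope ring_scope.

(* The coefficient d_i attached to f.  The truncated subtraction (i - k)%N is
   harmless because k <= i. *)
Definition dcoef (F : fieldType) (f : {poly F}) (i : nat) : F :=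
  \sum_(0 <= k < i.+1)
    (-1) ^+ k * f.[- k%:R] / (k`!%:R * (i - k)`!%:R).

(* Main.v *)
Require Import Defs.
From mathcomp Require Import all_boot all_order all_algebra.
From mathcomp Require Import reals complex.
From mathcomp Require Import ring.
Import GRing.Theory Num.Theory.
Local Open Scope ring_scope.
Local Open Scope complex_scope.

(** The numbers [dcoef f i] are the coefficients of Newton's interpolation
    formula for [f] at the nodes 0, -1, -2, ...: writing x^(i) for the rising
    factorial x (x + 1) ... (x + i - 1), every [f] of degree at most n satisfies
    f(x) = \sum_(i <= n) d_i x^(i)  ([newton_rising]).  Rising factorials sum
    by telescoping, \sum_(1 <= x <= m) x^(i) = m^(i + 1) / (i + 1)
    ([sum_rising]), so summing Newton's formula termwise gives the theorem, the
    term i = 0 being d_0 m = m f(0).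

    Newton's formula is proved by induction on the degree.  Write
    f(x) = f(0) + x g(x + 1) with deg g < deg f.  Since x (x + 1)^(i) =
    x^(i + 1), the expansion of g yields that of f once d_(i + 1)(f) = d_i(g)
    ([dcoefS_mulX]).  There the constant f(0) contributes nothing because the
    alternating sum of a row of binomial coefficients vanishes
    ([sum_sign_inv_fact]).  Only characteristic zero matters, so the argument is
    carried out over any [numFieldType], of which both [R] and [R[i]] are
    instances. *)

Definition rising {F : numFieldType} (x : F) (i : nat) : F :=
  \prod_(0 <= j < i) (x + j%:R).

Lemma natf_neq0 (F : numFieldType) (k : nat) : (k.+1%:R : F) != 0.
Proof. by rewrite pnatr_eq0. Qed.

Lemma fact_neq0 (F : numFieldType) (k : nat) : (k`!%:R : F) != 0.
Proof. by rewrite pnatr_eq0 -lt0n fact_gt0. Qed.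

Lemma risingS (F : numFieldType) (x : F) i :
  rising x i.+1 = rising x i * (x + i%:R).
Proof. by rewrite /rising big_nat_recr. Qed.

Lemma rising_recl (F : numFieldType) (x : F) i :
  rising x i.+1 = x * rising (x + 1) i.
Proof.
rewrite /rising big_nat_recl //= addr0; congr (_ * _).
by apply: eq_bigr => j _; rewrite -addrA -natr1 [1 + _]addrC.
Qed.

(** The difference (m + 1)^(i + 1) - m^(i + 1) equals (i + 1) (m + 1)^(i),
    since both terms contain the factor (m + 1)^(i). *)
Lemma sum_rising (F : numFieldType) (i m : nat) :
  \sum_(1 <= x < m.+1) rising x%:R i = rising (m%:R : F) i.+1 / i.+1%:R.
Proof.
elim: m => [|m IHm].
  by rewrite big_geq // rising_recl mul0r mul0r.
rewrite big_nat_recr //= IHm rising_recl risingS -!natr1.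
have := natf_neq0 F i; rewrite -natr1 => ni.
by field.
Qed.

(** Multiplied by (i + 1)!, this is the expansion of (1 - 1)^(i + 1). *)
Lemma sum_sign_inv_fact (F : numFieldType) (i : nat) :
  \sum_(0 <= k < i.+2) (-1) ^+ k / (k`!%:R * (i.+1 - k)`!%:R) = 0 :> F.
Proof.
apply: (mulfI (fact_neq0 F i.+1)); rewrite mulr0 big_distrr /=.
transitivity ((1 - 1 : F) ^+ i.+1); last by rewrite subrr expr0n.
rewrite exprDn big_mkord; apply: eq_bigr => k _.
have le_ki : (k <= i.+1)%N by rewrite -ltnS.
rewrite -(bin_fact le_ki) !natrM expr1n mul1r -mulr_natr.
have k0 := fact_neq0 F k; have ik0 := fact_neq0 F (i.+1 - k).
by field; rewrite k0 ik0.
Qed.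

Lemma dcoef0 (F : numFieldType) (f : {poly F}) : dcoef f 0 = f.[0].
Proof. by rewrite /dcoef big_nat1 expr0 mul1r oppr0 fact0 mulr1 divr1. Qed.

(** For f(x) = c + x q(x) and g(x) = q(x - 1), the k-th term of d_i(g) is the
    (k + 1)-st term of d_(i + 1)(f - c), whose term at 0 vanishes. *)
Lemma dcoefS_mulX (F : numFieldType) (q : {poly F}) (c : F) (i : nat) :
  dcoef (q * 'X + c%:P) i.+1 = dcoef (q \Po ('X - 1%:P)) i.
Proof.
rewrite /dcoef.
transitivity (\sum_(0 <= k < i.+2)
    ((-1) ^+ k * (q.[- k%:R] * - k%:R) / (k`!%:R * (i.+1 - k)`!%:R)
     + c * ((-1) ^+ k / (k`!%:R * (i.+1 - k)`!%:R)))).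
  apply: eq_bigr => k _.
  by rewrite hornerMXaddC mulrDr mulrDl [X in _ + X]mulrAC [X in _ + X]mulrC.
rewrite big_split /= -big_distrr /= sum_sign_inv_fact mulr0 addr0.
rewrite big_nat_recl //= oppr0 !mulr0 mul0r add0r.
apply: eq_bigr => k _.
rewrite horner_comp hornerXsubC subSS factS natrM exprS -natr1 opprD.
have := natf_neq0 F k; rewrite -natr1 => k1.
have k0 := fact_neq0 F k; have ik0 := fact_neq0 F (i - k).
by field; rewrite k0 ik0 k1.
Qed.

Lemma newton_rising (F : numFieldType) (n : nat) (f : {poly F}) (x : F) :
  (size f <= n)%N -> f.[x] = \sum_(0 <= i < n) dcoef f i * rising x i.
Proof.
elim: n f x => [|n IHn] f x.
  by rewrite leqn0 size_poly_eq0 => /eqP ->; rewrite horner0 big_geq.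
(* Only the decomposition f = q * X + c is used: the induction hypothesis is
   needed at the translate q(X - 1), hence the induction on a degree bound. *)
elim/poly_ind: f => [|q c _] size_f.
  rewrite horner0 big1 // => i _.
  by rewrite /dcoef big1 ?mul0r // => k _; rewrite horner0 mulr0 mul0r.
have size_q : (size q <= n)%N.
  move: size_f; rewrite size_MXaddC.
  by case: ifP => [/andP[/eqP -> _]|_] //; rewrite size_poly0.
have size_g : (size (q \Po ('X - 1%:P)) <= n)%N.
  by rewrite size_comp_poly2 ?size_XsubC.
rewrite big_nat_recl //= dcoef0 /rising big_geq // mulr1 -/(rising _ _).
rewrite !hornerMXaddC mulr0 add0r addrC; congr (_ + _).
have -> : q.[x] = (q \Po ('X - 1%:P)).[x + 1].
  by rewrite horner_comp !hornerE addrK.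
rewrite (IHn _ _ size_g) big_distrl /=; apply: eq_bigr => i _.
by rewrite dcoefS_mulX -/(rising x i.+1) rising_recl mulrAC mulrA mulrAC.
Qed.

Lemma sum_horner_nat (F : numFieldType) (n : nat) (f : {poly F}) (m : nat) :
  (size f <= n.+1)%N ->
  \sum_(1 <= x < m.+1) f.[x%:R] =
    m%:R * f.[0] +
    \sum_(1 <= i < n.+1)
      dcoef f i / i.+1%:R * \prod_(0 <= j < i.+1) (m%:R + j%:R).
Proof.
move=> size_f.
under eq_bigr => x _ do rewrite (newton_rising _ _ _ _ size_f).
rewrite exchange_big /= big_ltn //=; congr (_ + _); last first.
  apply: eq_bigr => i _.
  by rewrite -big_distrr /= sum_rising /rising mulrAC mulrA.
by rewrite -big_distrr /= sum_rising dcoef0 divr1 /rising big_nat1 addr0 mulrC.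
Qed.

Theorem theorem2p2 (R : realType) (n : nat) (hn : (1 <= n)%N) :
  (forall f : {poly R}, (size f <= n.+1)%N ->
     forall m : nat, (1 <= m)%N ->
     \sum_(1 <= x < m.+1) f.[x%:R] =
       m%:R * f.[0] +
       \sum_(1 <= i < n.+1)
          dcoef f i / i.+1%:R * \prod_(0 <= j < i.+1) (m%:R + j%:R))
  /\
  (forall f : {poly R[i]}, (size f <= n.+1)%N ->
     forall m : nat, (1 <= m)%N ->
     \sum_(1 <= x < m.+1) f.[x%:R] =
       m%:R * f.[0] +
       \sum_(1 <= i < n.+1)
          dcoef f i / i.+1%:R * \prod_(0 <= j < i.+1) (m%:R + j%:R)).
Proof.
split=> f size_f m _; first exact: sum_horner_nat.
exact: (@sum_horner_nat R[i]).
Qed.
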